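(* Fix $0 < \alpha \le 1$ and let $r_1$ be the largest real root of $P_{\alpha}(x) := \alpha^2x^3 - \alpha x^2 - 2\alpha x + 1$. There is no alternation-trading proof using the standard speedup rule and the generic slowdown rule with parameters $\alpha$ and $c$ that shows a contradiction for any $c > r_1$.
   Context: $\mathsf{TS}[t(n)]$: languages decidable by a deterministic random-access machine in space $n^{o(1)}$ and time $O(t(n)^{1+o(1)})$. An alternating class $(Q_1 n^{a_1})^{b_1}\cdots(Q_k n^{a_k})^{b_k}\mathsf{TS}[n^d]$ (positive constants $a_i,b_i,d$, quantifiers $Q_i\in\{\exists,\forall\}$) is the class of languages decided by a $(k+1)$-stage machine: stage $i$ receives a string of length $n^{a_i+o(1)}$ from quantifier $Q_i$ and, in space $n^{o(1)}$ and time $n^{b_i+o(1)}$, computes $n^{b_i+o(1)}$ bits for the next stage from this string and the previous stage's output (stage 1 gets the input); a final deterministic $n^{o(1)}$-space verifier runs in time $n^{d+o(1)}$ on stage $k$'s output; acceptance is as for $\Sigma_k/\Pi_k$ machines. A quantifier written $(Q\, x\log n)^{b}$ quantifies over strings of length $x\log n$. Set $b_0:=1$. An alternation-trading proof (with parameters $0<\alpha\le1<c$) is a finite list of alternating classes, each contained in the previous, each obtained from the previous by one of: (1) standard speedup on a class with no quantifiers: $\mathsf{TS}[n^d] \subseteq (\exists n^x)^{\max(x,1)} (\forall\, x\log n)^1 \mathsf{TS}[n^{d-x}]$ for some $x\in(0,d)$; (2) standard speedup on a class with $k\ge1$ quantifiers: $(Q_1 n^{a_1})^{b_1}\cdots(Q_k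 n^{a_k})^{b_k}\mathsf{TS}[n^d] \subseteq (Q_1 n^{a_1})^{b_1}\cdots(Q_k n^{\max(a_k,x)})^{\max(b_k,x)}(Q_{k+1}\, x\log n)^{b_k}\mathsf{TS}[n^{d-x}]$ for some $x\in(0,d)$, where $Q_{k+1}$ is the quantifier opposite to $Q_k$; (3) generic slowdown (on a class with $k\ge1$ quantifiers): $(Q_1 n^{a_1})^{b_1}\cdots(Q_k n^{a_k})^{b_k}\mathsf{TS}[n^d] \subseteq (Q_1 n^{a_1})^{b_1}\cdots(Q_{k-1} n^{a_{k-1}})^{b_{k-1}}\mathsf{TS}[n^{c\cdot\max(\alpha d, b_k, a_k, b_{k-1})}]$. The proof shows a contradiction for $c$ if it contains at least one speedup application and it shows $\mathsf{TS}[n^d]\subseteq\mathsf{TS}[n^{d'}]$ for some $d'\le d$ (its first class is $\mathsf{TS}[n^d]$ and its last is $\mathsf{TS}[n^{d'}]$). *)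

(* Defs.v *)
From mathcomp Require Import all_boot all_order all_algebra.
From mathcomp Require Import reals.

Set Implicit Arguments.
Unset Strict Implicit.
Unset Printing Implicit Defensive.

Import Order.TTheory GRing.Theory Num.Theory.
Local Open Scope ring_scope.

(* An alternating class is represented by the exponents annotating it: an
   alternation-trading proof manipulates the expressions
   (Q_1 n^a_1)^b_1 ... (Q_k n^a_k)^b_k TS[n^d], not the sets of languages they
   denote (the slowdown rule is an inclusion only under a complexity-theoretic
   assumption with parameters alpha and c). *)

Inductive quantifier := EX | ALL.

Definition opp_quantifier (q : quantifier) : quantifier :=
  match q with EX => ALL | ALL => EX end.

Inductive qlength (R : Type) :=
  | PolyLen of R   (* PolyLen a : strings of length n^(a + o(1)) *)
  | LogLen of R.   (* LogLen x : strings of length x * log n *)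

(* The exponent a such that the quantified string has length n^(a + o(1));
   x * log n is n^o(1). *)
Definition qexp (R : realType) (l : qlength R) : R :=
  match l with PolyLen a => a | LogLen _ => 0 end.

(* Block q l b is the quantifier (q l)^b. *)
Record block (R : Type) := Block {
  quant : quantifier;
  len : qlength R;
  outexp : R }.

(* AClass [:: B_1; ...; B_k] d is B_1 ... B_k TS[n^d], outermost block first. *)
Record aclass (R : Type) := AClass {
  blocks : seq (block R);
  dexp : R }.

Definition TS (R : Type) (d : R) : aclass R := AClass [::] d.

Definition block_wf (R : realType) (B : block R) : bool :=
  match len B with PolyLen a => 0 < a | LogLen x => 0 < x end
  && (0 < outexp B).

Definition aclass_wf (R : realType) (C : aclass R) : bool :=
  all (@block_wf R) (blocks C) && (0 < dexp C).

(* b_k for the k blocks of s, with b_0 = 1. *)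
Definition last_outexp (R : realType) (s : seq (block R)) : R :=
  last 1 (map (@outexp R) s).

Inductive speedup (R : realType) : aclass R -> aclass R -> Prop :=
  | SpeedupTS (d x : R) of 0 < x & x < d :
      speedup (TS d)
        (AClass [:: Block EX (PolyLen x) (Num.max x 1);
                    Block ALL (LogLen x) 1]
                (d - x))
  | SpeedupQ (s : seq (block R)) (q : quantifier) (l : qlength R)
      (b d x : R) of 0 < x & x < d :
      speedup (AClass (rcons s (Block q l b)) d)
        (AClass (s ++ [:: Block q (PolyLen (Num.max (qexp l) x)) (Num.max b x);
                          Block (opp_quantifier q) (LogLen x) b])
                (d - x)).

Inductive slowdown (R : realType) (alpha c : R) :
    aclass R -> aclass R -> Prop :=
  | Slowdown (s : seq (block R)) (q : quantifier) (l : qlength R) (b d : R) :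
      slowdown alpha c (AClass (rcons s (Block q l b)) d)
        (AClass s
           (c * Num.max (Num.max (Num.max (alpha * d) b) (qexp l))
                        (last_outexp s))).

Definition consecutive (T : Type) (p : seq T) (C D : T) : Prop :=
  exists p1 p2 : seq T, p = p1 ++ [:: C, D & p2].

Definition alternation_trading_proof (R : realType) (alpha c : R)
    (p : seq (aclass R)) : Prop :=
  all (@aclass_wf R) p /\
  forall C D : aclass R, consecutive p C D ->
    speedup C D \/ slowdown alpha c C D.

Definition shows_inclusion (R : realType) (p : seq (aclass R))
    (C D : aclass R) : Prop :=
  exists s : seq (aclass R), p = C :: s /\ last C s = D.

(* A speedup adds a block and a slowdown removes one, so consecutive classes
   related by speedup can only come from an application of a speedup rule. *)
Definition shows_contradiction (R : realType) (p : seq (aclass R)) : Prop :=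
  (exists C D : aclass R, consecutive p C D /\ speedup C D) /\
  (exists d d' : R, d' <= d /\ shows_inclusion p (TS d) (TS d')).

Definition Palpha (R : realType) (alpha : R) : {poly R} :=
  alpha ^+ 2 *: 'X^3 - alpha *: 'X^2 - (2 * alpha) *: 'X + 1.

Definition largest_root (R : realType) (p : {poly R}) (r : R) : Prop :=
  root p r /\ forall y : R, root p y -> y <= r.

(* Main.v *)
Require Import Defs.
From mathcomp Require Import all_boot all_order all_algebra.
From mathcomp Require Import reals.
From mathcomp Require Import ring lra.

(** Fix the exponent [t] of the last class [TS t] and read the proof backwards.
    Every class of the proof satisfies an upper bound on its [dexp] that depends
    only on [t] and on the [outexp]s of its blocks: a stack of blocks with
    exponents [b_1, ..., b_k] bounds [dexp] by [t_k], where [t_0 = t] and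
    [t_i = budget t_(i-1) b_i].  The slowdown that will eventually remove block
    [i] moreover forces [c * b_(i-1) <= t_(i-1)] and [c * b_i <= t_(i-1)].
    These bounds propagate backwards through both rules as soon as
    [1 < alpha * c] and [Palpha alpha] is positive at [c], which is the case
    beyond its largest root.  A proof of more than one class starts with a
    speedup of some [TS d], for which the bound reads [d <= budget t 1 < t]. *)

Set Implicit Arguments.
Unset Strict Implicit.
Unset Printing Implicit Defensive.

Import Order.TTheory GRing.Theory Num.Theory.
Local Open Scope ring_scope.

Lemma horner_Palpha (R : realType) (alpha x : R) :
  (Palpha alpha).[x]
  = alpha ^+ 2 * x ^+ 3 - alpha * x ^+ 2 - 2 * alpha * x + 1.
Proof. by rewrite /Palpha !hornerE. Qed.

(** [Palpha alpha] is nonnegative from [3 / alpha] on, so the intermediate value theorem yields a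
    root at or beyond [z]. *)
Lemma Palpha_le0_le_root (R : realType) (alpha r z : R) :
  0 < alpha -> alpha <= 1 -> largest_root (Palpha alpha) r ->
  (Palpha alpha).[z] <= 0 -> z <= r.
Proof.
move=> alpha_gt0 alpha_le1 [_ r_max] Pz_le0.
pose y := Num.max z (3 / alpha).
have le_zy : z <= y by rewrite le_max lexx.
have y_ge : 3 <= alpha * y.
  by rewrite mulrC -ler_pdivrMr// le_max lexx orbT.
have Py_ge0 : 0 <= (Palpha alpha).[y].
  rewrite -(pmulr_rge0 _ alpha_gt0) horner_Palpha.
  have -> : alpha * (alpha ^+ 2 * y ^+ 3 - alpha * y ^+ 2 - 2 * alpha * y + 1)
     = alpha * y * (alpha * y * (alpha * y - 1) - 2 * alpha) + alpha by ring.
  move: (alpha * y) y_ge => u u_ge.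
  have : 3 * 2 <= u * (u - 1) by apply: ler_pM => //; lra.
  by move=> u_quad; rewrite addr_ge0 ?mulr_ge0//; lra.
have [|w /andP[le_zw _] w_root] := poly_ivt le_zy (p := Palpha alpha).
  by rewrite Pz_le0.
exact: le_trans le_zw (r_max w w_root).
Qed.

Lemma gt_largest_root_Palpha (R : realType) (alpha r c : R) :
  0 < alpha -> alpha <= 1 -> largest_root (Palpha alpha) r -> r < c ->
  1 < alpha * c /\
  0 < alpha ^+ 2 * c ^+ 3 - alpha * c ^+ 2 - 2 * alpha * c + 1.
Proof.
move=> alpha_gt0 alpha_le1 r_max lt_rc; split.
  have : alpha^-1 <= r.
    (* The polynomial takes the value -1 at [alpha^-1]. *)
    apply: Palpha_le0_le_root r_max _ => //; rewrite horner_Palpha.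
    suff -> : alpha ^+ 2 * alpha^-1 ^+ 3 - alpha * alpha^-1 ^+ 2
            - 2 * alpha * alpha^-1 + 1 = -1 by rewrite lerN10.
    by field; rewrite gt_eqF.
  by move=> /le_lt_trans/(_ lt_rc); rewrite -[alpha^-1]mulr1 ltr_pdivrMl.
rewrite -horner_Palpha ltNge; apply/negP => Pc_le0.
have := Palpha_le0_le_root alpha_gt0 alpha_le1 r_max Pc_le0.
by rewrite leNgt lt_rc.
Qed.

(* [budget alpha c t b] is [t / c * g (b * c / t)], where [g x = c - x] for
   [x <= 1 / (alpha * c)] and [g x = 1 / alpha] otherwise. The function [g] is
   an upper bound for the largest exponent [d] that a class whose innermost
   block has exponent [x] may have if the slowdown removing this block
   yields an exponent at most [c]. *)
Definition budget (R : realType) (alpha c t b : R) : R :=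
  if alpha * c ^+ 2 * b <= t then t - b else t / (alpha * c).

Fixpoint within_budget (R : realType) (alpha c t b0 : R) (s : seq (block R))
    (d : R) : bool :=
  if s is B :: s' then
    [&& c * b0 <= t, c * outexp B <= t &
        within_budget alpha c (budget alpha c t (outexp B)) (outexp B) s' d]
  else d <= t.

Section Budget.
Variables (R : realType) (alpha c : R).
Hypotheses (alpha_gt0 : 0 < alpha) (alphac_gt1 : 1 < alpha * c).
Hypothesis Pc_gt0 :
  0 < alpha ^+ 2 * c ^+ 3 - alpha * c ^+ 2 - 2 * alpha * c + 1.

Let c_gt0 : 0 < c.
Proof. by rewrite -(pmulr_rgt0 _ alpha_gt0) (lt_trans ltr01). Qed.

Let alphac_gt0 : 0 < alpha * c. Proof. exact: mulr_gt0. Qed.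

Lemma budget_lt (t b : R) : 0 < t -> 0 < b -> budget alpha c t b < t.
Proof.
move=> t_gt0 b_gt0; rewrite /budget; case: ifP => _; first by rewrite gtrBl.
by rewrite ltr_pdivrMr// ltr_pMr.
Qed.

Lemma le_budget (t b d : R) :
  0 <= t -> c * (alpha * d) <= t -> d <= budget alpha c t b.
Proof.
move=> t_ge0 le_dt.
have le_d : d <= t / (alpha * c).
  by rewrite ler_pdivlMr// (_ : d * _ = c * (alpha * d)) //; ring.
rewrite /budget; case: ifP => // le_bt; apply: le_trans le_d _.
(* With [alpha * c ^+ 2 * b <= t], this gives [t / (alpha * c) <= t - b]. *)
have quad_gt0 : 0 < alpha * c ^+ 2 - c - 1.
  rewrite -(pmulr_rgt0 _ alphac_gt0).
  have -> : alpha * c * (alpha * c ^+ 2 - c - 1)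
    = (alpha ^+ 2 * c ^+ 3 - alpha * c ^+ 2 - 2 * alpha * c + 1)
      + (alpha * c - 1) by ring.
  by rewrite addr_gt0 ?subr_gt0.
rewrite ler_pdivrMr// -(ler_pM2r c_gt0).
have : t * (c + 1) <= t * (alpha * c ^+ 2) by apply: ler_wpM2l => //; lra.
nra.
Qed.

(** The hypothesis on [c * y] puts [y], hence also [b], in the linear branch of [budget] at [t].
    Only the branch of the inner budget at [b] remains open. *)
Lemma budget_speedup (t b y : R) :
  0 < b -> b <= y -> c * y <= budget alpha c t y ->
  y + budget alpha c (budget alpha c t y) b <= budget alpha c t b.
Proof.
move=> b_gt0 le_by le_yE.
have le_yt : alpha * c ^+ 2 * y <= t.
  move: le_yE; rewrite /budget; case: ifP => // <-; rewrite ler_pdivlMr//.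
  by rewrite (_ : c * y * (alpha * c) = alpha * c ^+ 2 * y) //; ring.
have -> : budget alpha c t y = t - y by rewrite /budget le_yt.
have ac2_ge0 : 0 <= alpha * c ^+ 2 by rewrite mulr_ge0 ?exprn_ge0 ?ltW.
have le_bt : alpha * c ^+ 2 * b <= t.
  by apply: le_trans le_yt; apply: ler_wpM2l.
have -> : budget alpha c t b = t - b by rewrite /budget le_bt.
rewrite /budget; case: ifP => _; first by lra.
suff : (t - y) / (alpha * c) <= t - 2 * y by lra.
(* The inequality is linear in [t]; at the least admissible [t], [alpha * c ^+ 2 * y], it says that
   [y] times the value of [Palpha alpha] at [c] is nonnegative. *)
rewrite ler_pdivrMr//.
have : 0 <= y * (alpha ^+ 2 * c ^+ 3 - alpha * c ^+ 2 - 2 * alpha * c + 1).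
  by rewrite mulr_ge0 ?ltW// (lt_le_trans b_gt0).
have : 0 <= (alpha * c - 1) * (t - alpha * c ^+ 2 * y).
  by rewrite mulr_ge0// subr_ge0 // ltW.
nra.
Qed.

(** Both rules rewrite only the innermost blocks, and the prefix [s] influences them only through
    the remaining budget and its last [outexp]. *)
Lemma within_budget_cat (t b0 : R) (s u v : seq (block R)) (d e : R) :
  (forall t', within_budget alpha c t' (last b0 (map (@outexp R) s)) u d ->
              within_budget alpha c t' (last b0 (map (@outexp R) s)) v e) ->
  within_budget alpha c t b0 (s ++ u) d ->
  within_budget alpha c t b0 (s ++ v) e.
Proof.
elim: s t b0 => [|B s IHs] t b0 /= uv; first exact: uv.
by case/and3P=> -> -> /=; apply: IHs.
Qed.

Lemma within_budget_speedup (t b0 d x : R) (B B1 B2 : block R) :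
  0 < outexp B -> outexp B1 = Num.max (outexp B) x -> outexp B2 = outexp B ->
  within_budget alpha c t b0 [:: B1; B2] (d - x) ->
  within_budget alpha c t b0 [:: B] d.
Proof.
move=> b_gt0 /= -> ->; set y := Num.max _ x.
have le_by : outexp B <= y by rewrite le_max lexx.
have le_xy : x <= y by rewrite le_max lexx orbT.
case/and3P=> -> le_yt /and3P[le_yE _ le_d] /=; apply/andP; split.
  by apply: le_trans le_yt; rewrite ler_pM2l.
have := @budget_speedup t _ _ b_gt0 le_by le_yE; lra.
Qed.

Lemma within_budget_TS_step (t d : R) (D : aclass R) :
  speedup (TS d) D \/ slowdown alpha c (TS d) D ->
  within_budget alpha c t 1 (blocks D) (dexp D) -> d < t.
Proof.
move CE: (TS d) => C [] stepD; case: stepD CE.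
  (* A speedup of [TS d] acts as a speedup on a class whose only block has
     exponent 1; only [outexp] matters, so the other fields are arbitrary. *)
- move=> e x _ _ [<-] D_budget.
  have := @within_budget_speedup t 1 d x (Block EX (LogLen x) 1) _ _
    ltr01 _ _ D_budget.
  rewrite /= maxC => /(_ erefl erefl)/and3P[le_ct _ /le_lt_trans]; apply.
  by rewrite budget_lt// (lt_le_trans _ le_ct)// mulr1.
- by case.
- by case.
Qed.

Lemma within_budget_step (t : R) (C D : aclass R) :
  aclass_wf C -> speedup C D \/ slowdown alpha c C D ->
  within_budget alpha c t 1 (blocks D) (dexp D) ->
  within_budget alpha c t 1 (blocks C) (dexp C).
Proof.
have last_wf (s : seq (block R)) q l b d :
    aclass_wf (AClass (rcons s (Block q l b)) d) -> 0 < b.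
  by case/andP; rewrite all_rcons => /andP[/andP[]].
move=> C_wf [] stepCD; case: stepCD C_wf.
- move=> d x x_gt0 lt_xd _ D_budget; apply: ltW.
  exact: within_budget_TS_step (or_introl (SpeedupTS x_gt0 lt_xd)) D_budget.
- move=> s q l b d x _ _ /last_wf b_gt0.
  rewrite /= -cats1; apply: within_budget_cat => t'.
  exact: within_budget_speedup.
- move=> s q l b d /last_wf b_gt0.
  rewrite /= -cats1 -[X in within_budget _ _ _ _ X]cats0.
  apply: within_budget_cat => t' /=; rewrite -/(last_outexp s).
  (* The terms of the maximum bound [alpha * d], [b] and the previous [outexp]: what the removed
     block has to satisfy. *)
  rewrite -ler_pdivlMl// !ge_max !ler_pdivlMl// => /andP[/andP[/andP[le_d le_b] _] ->].
  rewrite le_b /= le_budget//.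
  by apply: le_trans le_b; rewrite ltW ?mulr_gt0.
Qed.

Lemma within_budget_proof (t : R) (C : aclass R) (s : seq (aclass R)) :
  alternation_trading_proof alpha c (C :: s) -> last C s = TS t ->
  within_budget alpha c t 1 (blocks C) (dexp C).
Proof.
elim: s C => [|D s IHs] C [/= /andP[C_wf s_wf] s_step] lastE.
  by rewrite lastE /=.
apply: (@within_budget_step t C D C_wf); first by apply: s_step; exists [::], s.
apply: IHs => //; split=> // C' D' [p1 [p2 s_eq]].
by apply: s_step; exists (C :: p1), p2; rewrite s_eq.
Qed.

End Budget.

Theorem theoremA1 (R : realType) (alpha r1 : R)
  (alpha_gt0 : 0 < alpha) (alpha_le1 : alpha <= 1)
  (r1_largest : largest_root (Palpha alpha) r1) (c : R) (r1_lt_c : r1 < c) :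
  ~ exists p : seq (aclass R),
      alternation_trading_proof alpha c p /\ shows_contradiction p.
Proof.
have [alphac_gt1 Pc_gt0] :=
  gt_largest_root_Palpha alpha_gt0 alpha_le1 r1_largest r1_lt_c.
case=> p [[p_wf p_step] [[C [D [[p1 [p2 p_CD]] _]]]]].
case=> d [t [le_td [s [p_s lastE]]]].
case: s => [|E s] in p_s lastE.
  (* A single class has no consecutive pair, hence no speedup. *)
  by case: p1 p_CD => [|? [|? ?]]; rewrite p_s.
have E_budget : within_budget alpha c t 1 (blocks E) (dexp E).
  move: p_wf p_step lastE; rewrite {}p_s /= => /andP[_ E_wf] p_step lastE.
  apply: (within_budget_proof alpha_gt0 alphac_gt1 Pc_gt0 _ lastE); split=> //.
  move=> C' D' [q1 [q2 q_eq]]; apply: p_step.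
  by exists (TS d :: q1), q2; rewrite q_eq.
have /p_step step_E : consecutive p (TS d) E by exists [::], s.
have := within_budget_TS_step alpha_gt0 alphac_gt1 Pc_gt0 step_E E_budget.
by rewrite ltNge le_td.
Qed.
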